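(* For every graph $H$ with $t$ vertices and $q$ edges, $f(H)\leq t+6.291q$.
   Context: All graphs are finite and simple. A graph $H$ is a minor of a graph $G$ if a graph isomorphic to $H$ can be obtained from a subgraph of $G$ by contracting edges. For a graph $H$, $f(H)$ denotes the infimum of all numbers $d$ such that every graph with average degree at least $d$ contains $H$ as a minor. *)

(* Defs.v *)
From HB Require Import structures.
From mathcomp Require Import all_boot all_order all_algebra.
From mathcomp Require Import all_classical all_reals.
From mathcomp Require Import ereal.
Set Implicit Arguments. Unset Strict Implicit. Unset Printing Implicit Defensive.
Import Order.TTheory GRing.Theory Num.Theory.

Definition simple_graph (T : finType) (e : rel T) : Prop :=
  symmetric e /\ irreflexive e.

Definition edges (T : finType) (e : rel T) : {set {set T}} :=
  [set E : {set T} | [exists x, exists y, e x y && (E == [set x; y])]].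

Definition nedges (T : finType) (e : rel T) : nat := #|edges e|.

(* Average degree 2|E|/|V| (taken to be 0 for the graph with no vertex). *)
Definition avg_degree (R : realType) (T : finType) (e : rel T) : R :=
  ((2 * nedges e)%:R / #|T|%:R)%R.

Definition connected_in (T : finType) (e : rel T) (B : {set T}) : bool :=
  [forall x in B, forall y in B,
     connect [rel u v | [&& e u v, u \in B & v \in B]] x y].

Definition is_minor (TH : finType) (eH : rel TH) (TG : finType) (eG : rel TG)
  : Prop :=
  exists phi : TH -> {set TG},
    [/\ forall u, phi u != finset.set0,
        forall u v, u != v -> [disjoint phi u & phi v],
        forall u, connected_in eG (phi u) &
        forall u v, eH u v ->
          exists x, exists y, [/\ x \in phi u, y \in phi v & eG x y]].

Definition fH (R : realType) (TH : finType) (eH : rel TH) : \bar R :=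
  ereal_inf [set (d%:E : \bar R) | d in
    [set d : R | forall (TG : finType) (eG : rel TG),
        simple_graph eG -> (d <= avg_degree R eG)%R -> is_minor eH eG]].

(* Main.v *)
Require Import Defs.
From mathcomp Require Import all_boot all_order all_algebra perm.
From mathcomp Require Import zify ring lra.
From mathcomp Require Import reals exp.
Set Implicit Arguments. Unset Strict Implicit. Unset Printing Implicit Defensive.
Import Order.TTheory GRing.Theory Num.Theory.

(** Let [G] have average degree at least [D = t + 6.291 q] and argue by induction
on [t].  An isolated vertex of [H] is placed on a vertex of minimum degree of
[G], which lowers the average degree by at most 1.  If [t > q] then
some component of [H] is a tree; it embeds greedily in a subgraph of [G] of
minimum degree at least [D / 2], and deleting its [s] image vertices lowers the
average degree by at most [2 s], less than the component contributes to [D].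

If [t <= q], contract edges and delete vertices of [G] as long as this does not
decrease the average degree; a closed neighbourhood [N] of a vertex of minimum
degree then has at most [2 d + 1] vertices and minimum degree at least [d], for
some [d >= D / 2].  Following Mader, continue to contract inside [N], now
keeping [|E| / m >= (d / 2) (1 - b ln (2 d / (m - 1)))] for the current number
[m] of vertices, with [b = 0.362].  The process stops at a minor with a closed
neighbourhood [W] of [k + 1 <= d + 2] vertices in which all degrees are at
least [(k + b d) / 2].  A random injection of [V(H)] into [W] maps at most
[q (1 - b d / k) / 2] edges of [H] to non-edges, and any two non-adjacent
vertices of [W] have more than [b d] common neighbours, enough to join the
missing pairs by disjoint paths of length two. *)

(** * Connected branch sets and composition of minors *)

Lemma connected_in_sub (T : finType) (e e' : rel T) (B : {set T}) :
  subrel e e' -> connected_in e B -> connected_in e' B.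
Proof.
move=> ee' /forall_inP cB; apply/forall_inP => x xB; apply/forall_inP => y yB.
apply: connect_sub (forall_inP (cB x xB) y yB) => a b /and3P[ab aB bB].
by apply: connect1; rewrite /= ee' // aB bB.
Qed.

Lemma connected_in1 (T : finType) (e : rel T) x : connected_in e [set x].
Proof.
by apply/forall_inP => a /set1P->; apply/forall_inP => b /set1P->.
Qed.

Lemma connected_in_star (T : finType) (e : rel T) (B : {set T}) c :
  symmetric e -> c \in B -> {in B, forall x, x = c \/ e c x} ->
  connected_in e B.
Proof.
move=> symE cB star; apply/forall_inP => x xB; apply/forall_inP => y yB.
apply: (@connect_trans _ _ c).
  case: (star x xB) => [->|cx]; first exact: connect0.
  by apply: connect1; rewrite /= symE cx xB cB.
case: (star y yB) => [->|cy]; first exact: connect0.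
by apply: connect1; rewrite /= cy yB cB.
Qed.

(** A path of [eM] inside [B] lifts to [eG]: each of its edges joins consecutive branch sets, and
    within a branch set connectedness links the point of arrival to the point of departure. *)
Lemma connected_in_bigcup (TM TG : finType) (eM : rel TM) (eG : rel TG)
    (psi : TM -> {set TG}) (B : {set TM}) :
  (forall w, connected_in eG (psi w)) ->
  (forall u v, eM u v ->
     exists x, exists y, [/\ x \in psi u, y \in psi v & eG x y]) ->
  connected_in eM B -> connected_in eG (\bigcup_(w in B) psi w).
Proof.
move=> conn adj cB; apply/forall_inP => x /bigcupP[w wB xw].
apply/forall_inP => y /bigcupP[w' w'B yw'].
have /connectP[p pP ew'] := forall_inP (forall_inP cB w wB) w' w'B.
have inside a b z : z \in B -> a \in psi z -> b \in psi z ->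
    connect [rel u v | [&& eG u v, u \in \bigcup_(w in B) psi w
                                 & v \in \bigcup_(w in B) psi w]] a b.
  move=> zB az bz; apply: connect_sub (forall_inP (forall_inP (conn z) a az) b bz).
  move=> c d /and3P[cd cz dz]; apply: connect1; rewrite /= cd /=.
  by apply/andP; split; apply/bigcupP; exists z.
elim: p w wB x xw pP ew' => [|w1 p IH] w wB x xw /=.
  by move=> _ ew; subst w'; apply: inside yw'.
move=> /andP[/and3P[ww1 _ w1B] pP] ew'.
have [a [b [aw bw1 ab]]] := adj _ _ ww1.
apply: connect_trans (inside _ _ _ wB xw aw) _.
apply: connect_trans (IH _ w1B _ bw1 pP ew').
apply: connect1; rewrite /= ab /=.
by apply/andP; split; apply/bigcupP; [exists w | exists w1].
Qed.

Lemma is_minor_trans (TH TM TG : finType)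
    (eH : rel TH) (eM : rel TM) (eG : rel TG) :
  is_minor eH eM -> is_minor eM eG -> is_minor eH eG.
Proof.
move=> [phi [phi0 phiD phiC phiE]] [psi [psi0 psiD psiC psiE]].
exists (fun u => \bigcup_(w in phi u) psi w); split.
- move=> u; have /set0Pn[w wu] := phi0 u; have /set0Pn[x xw] := psi0 w.
  by apply/set0Pn; exists x; apply/bigcupP; exists w.
- move=> u v uv; apply/pred0P => x /=; apply/negbTE/negP.
  move=> /andP[/bigcupP[w wu xw] /bigcupP[w' w'v xw']].
  have [ww'|ww'] := eqVneq w w'.
    by have := disjointFr (phiD _ _ uv) wu; rewrite ww' w'v.
  by have := disjointFr (psiD _ _ ww') xw; rewrite xw'.
- by move=> u; apply: connected_in_bigcup psiC psiE (phiC u).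
- move=> u v /phiE[w [w' [wu w'v ww']]].
  have [x [y [xw yw' xy]]] := psiE _ _ ww'.
  by exists x, y; split=> //; apply/bigcupP; [exists w | exists w'].
Qed.

Lemma is_minor_refl (T : finType) (e : rel T) : is_minor e e.
Proof.
exists (fun x => [set x]); split=> [u|u v uv|u|u v uv].
- by apply/set0Pn; exists u; apply: set11.
- by rewrite disjoints1 inE.
- exact: connected_in1.
- by exists u, v; rewrite !set11.
Qed.

Lemma is_minor_subrel (T : finType) (e e' : rel T) :
  subrel e e' -> is_minor e e'.
Proof.
move=> ee'; have [phi [h0 hD hC hE]] := is_minor_refl e; exists phi.
split=> // [u|u v /hE[x [y [xu yv /ee' xy]]]]; last by exists x, y.
exact: connected_in_sub ee' (hC u).
Qed.

(** * Induced subgraphs and degree counts *)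

Definition induced (T : finType) (e : rel T) (S : {set T}) :
    rel {x | x \in S} :=
  fun x y => e (val x) (val y).
Arguments induced {T} e S.

Lemma induced_simple (T : finType) (e : rel T) (S : {set T}) :
  simple_graph e -> simple_graph (induced e S).
Proof.
by case=> symE irrE; split=> [x y|x]; rewrite /induced ?(symE (val x)) ?irrE.
Qed.

Lemma card_induced (T : finType) (S : {set T}) : #|{: {x | x \in S}}| = #|S|.
Proof. by rewrite card_sig; apply: eq_card => x; rewrite inE. Qed.

Lemma induced_minor (T : finType) (e : rel T) (S : {set T}) :
  is_minor (induced e S) e.
Proof.
exists (fun x => [set val x]); split=> [u|u v uv|u|u v uv].
- by apply/set0Pn; exists (val u); apply: set11.
- by rewrite disjoints1 inE val_eqE.
- exact: connected_in1.
- by exists (val u), (val v); rewrite !set11.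
Qed.

(* Edges are counted as ordered pairs, so [arcs e] is twice the number of edges. *)
Definition deg_in (T : finType) (e : rel T) (S : {set T}) x : nat :=
  \sum_(y in S) e x y.

Definition arcs_in (T : finType) (e : rel T) (S : {set T}) : nat :=
  \sum_(x in S) deg_in e S x.

Definition deg (T : finType) (e : rel T) x : nat := \sum_y e x y.

Definition arcs (T : finType) (e : rel T) : nat := \sum_x deg e x.

Lemma deg_inE (T : finType) (e : rel T) (S : {set T}) x :
  deg_in e S x = #|[set y in S | e x y]|.
Proof.
rewrite -sum1_card /deg_in big_mkcond [RHS]big_mkcond; apply: eq_bigr => y _.
by rewrite inE; case: (y \in S) => //=; case: (e x y).
Qed.

Lemma deg_inT (T : finType) (e : rel T) x : deg_in e setT x = deg e x.
Proof. by apply: eq_bigl => y; rewrite inE. Qed.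

Lemma arcs_inT (T : finType) (e : rel T) : arcs_in e setT = arcs e.
Proof. by apply: eq_big => [y|x _]; rewrite ?inE ?deg_inT. Qed.

Lemma degE (T : finType) (e : rel T) x : deg e x = #|[set y | e x y]|.
Proof. by rewrite -deg_inT deg_inE; apply: eq_card => y; rewrite !inE. Qed.

Lemma deg_induced (T : finType) (e : rel T) (S : {set T}) x :
  deg (induced e S) x = deg_in e S (val x).
Proof.
by rewrite /deg_in (big_sub (mem S) (fun y => e (val x) y : nat)).
Qed.

Lemma arcs_induced (T : finType) (e : rel T) (S : {set T}) :
  arcs (induced e S) = arcs_in e S.
Proof.
rewrite /arcs_in (big_sub (mem S) (deg_in e S)).
by apply: eq_bigr => x _; rewrite deg_induced.
Qed.

Lemma deg_inD1 (T : finType) (e : rel T) (S : {set T}) x y :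
  x \in S -> deg_in e S y = e y x + deg_in e (S :\ x) y.
Proof.
move=> xS; rewrite /deg_in (bigD1 x) //=; congr (_ + _).
by apply: eq_bigl => z; rewrite !inE andbC.
Qed.

Lemma arcs_inD1 (T : finType) (e : rel T) (S : {set T}) x :
  simple_graph e -> x \in S ->
  arcs_in e S = arcs_in e (S :\ x) + 2 * deg_in e S x.
Proof.
move=> [symE irrE] xS; rewrite /arcs_in (bigD1 x) //=.
have -> : \sum_(i in S | i != x) deg_in e S i =
          \sum_(i in S :\ x) (e i x + deg_in e (S :\ x) i).
  apply: eq_big => [z|z _]; first by rewrite !inE andbC.
  exact: deg_inD1.
rewrite big_split /= (eq_bigr (fun i => e x i : nat)); last first.
  by move=> i _; rewrite symE.
rewrite [deg_in e S x](deg_inD1 _ _ xS) irrE add0n /deg_in; lia.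
Qed.

Lemma deg_in_setC1 (T : finType) (e : rel T) v x :
  deg e x = e x v + deg_in e [set~ v] x.
Proof. by rewrite -deg_inT (deg_inD1 _ _ (in_setT v)) setTD. Qed.

Lemma arcs_in_setC1 (T : finType) (e : rel T) v :
  simple_graph e -> arcs e = arcs_in e [set~ v] + 2 * deg e v.
Proof. by move=> sE; rewrite -arcs_inT (arcs_inD1 sE (in_setT v)) setTD deg_inT. Qed.

Lemma leq_deg_card (T : finType) (e : rel T) x :
  irreflexive e -> deg e x < #|T|.
Proof.
move=> irrE; rewrite degE -cardsT; apply/proper_card/properP.
by split; [apply: subsetT | exists x; rewrite ?inE ?irrE].
Qed.

Lemma leq_arcs_card (T : finType) (e : rel T) :
  irreflexive e -> arcs e <= #|T| * (#|T| - 1).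
Proof.
move=> irrE; rewrite -sum_nat_const; apply: leq_sum => x _.
by have := leq_deg_card x irrE; lia.
Qed.

Lemma arcs_nedges (T : finType) (e : rel T) :
  simple_graph e -> arcs e = 2 * nedges e.
Proof.
move=> [symE irrE]; rewrite /arcs.
have -> : \sum_x deg e x = \sum_(p : T * T | e p.1 p.2) 1.
  rewrite [RHS]big_mkcond /= pair_bigA /=; apply: eq_bigr => -[x y] _ /=.
  by case: (e x y).
rewrite (partition_big (fun p => [set p.1; p.2]) (mem (edges e))) /=; last first.
  move=> [x y] /= xy; rewrite inE; apply/existsP; exists x; apply/existsP.
  by exists y; rewrite xy eqxx.
rewrite mulnC -sum_nat_const; apply: eq_bigr => E.
rewrite inE => /existsP[x /existsP[y /andP[xy /eqP->]]].
have xNy : x != y by apply: contraTneq xy => ->; rewrite irrE.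
have -> : \sum_(p : T * T | e p.1 p.2 && ([set p.1; p.2] == [set x; y])) 1 =
    \sum_(p in [set (x, y); (y, x)]) 1.
  apply: eq_bigl => -[a b]; rewrite !inE /= !xpair_eqE; apply/idP/idP => H.
    move: H.
    move=> /andP[ab /eqP/setP eq]; have := eq a; have := eq b.
    have aNb : a != b by apply: contraTneq ab => ->; rewrite irrE.
    rewrite !inE !eqxx orbT /= => /esym/orP[]/eqP bE /esym/orP[]/eqP aE;
      move: aNb; rewrite aE bE ?eqxx ?orbT //.
  case/orP: H => /andP[/eqP-> /eqP->]; first by rewrite xy eqxx.
  by rewrite symE xy setUC eqxx.
by rewrite sum1_card cards2 xpair_eqE (negbTE xNy).
Qed.

(** * Contracting an edge *)

(* [w] is merged into [v] but remains a vertex: the contraction of [v w] is the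
   graph induced on the complement of [w]. *)
Definition merge_vertices (T : finType) (e : rel T) v w : rel T :=
  fun x y => (x != y) && [|| e x y, (x == v) && e w y | (y == v) && e x w].

Lemma merge_vertices_simple (T : finType) (e : rel T) v w :
  simple_graph e -> simple_graph (merge_vertices e v w).
Proof.
move=> [symE irrE]; split=> [x y|x]; rewrite /merge_vertices ?eqxx //.
by rewrite eq_sym (symE x y) (symE x w) (symE w y); congr (_ && (_ || _)); rewrite orbC.
Qed.

Lemma merge_vertices_minor (T : finType) (e : rel T) v w :
  simple_graph e -> e v w -> is_minor (induced (merge_vertices e v w) [set~ w]) e.
Proof.
move=> [symE irrE] vw.
pose phi (x : {x | x \in [set~ w]}) :=
  if val x == v then [set v; w] else [set val x].
have phiP x : val x \in phi x.
  by rewrite /phi; case: eqP => [->|_]; rewrite !inE eqxx.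
have valNw (x : {x | x \in [set~ w]}) : val x != w by have := valP x; rewrite !inE.
have phiK x z : z \in phi x -> (if z == w then v else z) = val x.
  rewrite /phi; case: eqP => [->|_]; rewrite !inE.
    by case/orP => /eqP->; rewrite ?eqxx //; case: eqP.
  by move/eqP->; rewrite (negbTE (valNw x)).
exists phi; split.
- by move=> u; apply/set0Pn; exists (val u).
- move=> x y; apply: contraR => /pred0Pn[z /= /andP[/phiK xz /phiK yz]].
  by apply/eqP/val_inj; rewrite -xz -yz.
- move=> x; rewrite /phi; case: eqP => _; last exact: connected_in1.
  apply: (@connected_in_star _ _ _ v) => //; first by rewrite !inE eqxx.
  by move=> z; rewrite !inE => /orP[]/eqP->; [left|right].
- move=> x y /andP[_ /or3P[xy|/andP[xv wy]|/andP[yv xw]]].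
  + by exists (val x), (val y).
  + by exists w, (val y); rewrite /phi xv !inE eqxx orbT; split=> //; apply: phiP.
  + by exists (val x), w; rewrite [phi y]/phi yv !inE eqxx orbT; split.
Qed.

Definition codeg (T : finType) (e : rel T) v w : nat := \sum_y (e v y && e w y).

(** Contraction destroys the edge [v w] itself and, for each common neighbour, one of two edges that
    become parallel; every lost edge is two arcs. *)
Lemma arcs_merge_vertices (T : finType) (e : rel T) v w :
  simple_graph e -> e v w ->
  arcs e = arcs (induced (merge_vertices e v w) [set~ w]) + 2 * (codeg e v w).+1.
Proof.
move=> sE vw; have [symE irrE] := sE.
have vNw : v != w by apply: contraTneq vw => ->; rewrite irrE.
have vI : v \in [set~ w] by rewrite !inE.
rewrite arcs_induced (arcs_in_setC1 w sE) (arcs_inD1 sE vI).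
rewrite (arcs_inD1 (merge_vertices_simple v w sE) vI).
have -> : arcs_in (merge_vertices e v w) ([set~ w] :\ v) = arcs_in e ([set~ w] :\ v).
  apply: eq_bigr => x; rewrite !inE => /andP[xv xw]; apply: eq_bigr => y.
  rewrite !inE /merge_vertices (negbTE xv) => /andP[/negbTE-> yw]; rewrite /= orbF.
  by case: eqVneq => [->|//]; rewrite irrE.
suff : deg_in e [set~ w] v + deg e w =
    (codeg e v w).+1 + deg_in (merge_vertices e v w) [set~ w] v.
  lia.
rewrite (deg_in_setC1 e w w) irrE add0n /codeg (bigD1 w) //= irrE andbF add0n.
have -> : \sum_(i | i != w) (e v i && e w i) = \sum_(i in [set~ w]) (e v i && e w i).
  by apply: eq_bigl => i; rewrite !inE.
(* The successor is written as the sum of the indicator of [i = v], so that the two sides compare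
   term by term. *)
have E1 : \sum_(i in [set~ w]) (i == v : nat) = 1.
  by rewrite (bigD1 v) //= eqxx big1 // => i /andP[_ /negbTE->].
rewrite -add1n -[X in _ = X + _ + _]E1.
rewrite /deg_in -!big_split /=; apply: eq_bigr => y; rewrite !inE => yw.
rewrite /merge_vertices eqxx /= [v == y]eq_sym; case: (eqVneq y v) => [->|yv] /=.
  by rewrite irrE symE vw.
by rewrite orbF; case: (e v y); case: (e w y).
Qed.

(** Take [v] of minimum degree. Deleting [v] costs [2 deg v] arcs and contracting [v w] costs
    [2 (codeg v w + 1)]. If neither is cheap, the closed neighbourhood of [v] has all degrees at
    least [x], and its size is controlled because the minimum degree is at most the average. *)
Lemma closed_nbhd_or_smaller_minor (R : realFieldType) (T : finType) (e : rel T)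
    (x : R) :
  simple_graph e -> 0 < #|T| ->
  (exists (T' : finType) (e' : rel T'),
     [/\ simple_graph e', #|T'| = #|T|.-1, is_minor e' e
       & ((arcs e)%:R <= (arcs e')%:R + 2%:R * x)%R])
  \/ (exists S : {set T},
     [/\ 0 < #|S|, #|S|.-1 * #|T| <= arcs e
       & {in S, forall y, (x <= (deg_in e S y)%:R)%R}]).
Proof.
move=> sE T0; have [symE irrE] := sE.
have [v0 _] : exists v : T, true by case/card_gt0P: T0 => v; exists v.
have [v _ vmin] := @arg_minnP T v0 xpredT (deg e) isT.
have cardC (w : T) : #|{: {x | x \in [set~ w]}}| = #|T|.-1.
  by rewrite card_induced cardsC1.
have [ltx|lex] := ltrP (deg e v)%:R%R x.
  left; exists {x | x \in [set~ v]}, (induced e [set~ v]); split=> //.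
  - exact: induced_simple.
  - exact: cardC.
  - exact: induced_minor.
  - rewrite arcs_induced (arcs_in_setC1 v sE) natrD natrM lerD2l.
    by rewrite ler_pM2l ?ltr0n // ltW.
case: (boolP [exists w, e v w && ((codeg e v w).+1%:R < x)%R]) => [/existsP[w]|].
  move=> /andP[vw ltx]; left.
  exists {x | x \in [set~ w]}, (induced (merge_vertices e v w) [set~ w]); split=> //.
  - exact/induced_simple/merge_vertices_simple.
  - exact: cardC.
  - exact: merge_vertices_minor.
  - rewrite (arcs_merge_vertices sE vw) natrD natrM lerD2l.
    by rewrite ler_pM2l ?ltr0n // ltW.
move=> /existsPn far; right; exists (v |: [set y | e v y]).
have vN : v \notin [set y | e v y] by rewrite inE irrE.
split; first by rewrite cardsU1 vN.
  rewrite cardsU1 vN /= add0n -degE mulnC -sum_nat_const.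
  by apply: leq_sum => y _; apply: vmin.
move=> w; rewrite !inE => /orP[/eqP->|vw].
  by rewrite deg_inE (_ : [set _ in _ | _] = [set y | e v y]) -?degE //;
    apply/setP => y; rewrite !inE; case: (e v y); rewrite ?orbT ?andbF.
have := far w; rewrite vw /= -leNgt => /le_trans; apply; rewrite ler_nat.
have -> : codeg e v w = #|[set y | e v y && e w y]|.
  rewrite -sum1_card [RHS]big_mkcond; apply: eq_bigr => y _.
  by rewrite inE; case: (_ && _).
(* Besides the common neighbours, [w] has the neighbour [v] in the closed neighbourhood, which
   accounts for the successor. *)
have := cardsU1 v [set y | e v y && e w y]; rewrite inE irrE /= add1n deg_inE => <-.
apply/subset_leq_card/subsetP => y; rewrite !inE => /orP[/eqP->|/andP[-> ->]].
  by rewrite eqxx symE.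
by rewrite orbT.
Qed.

(** * Tree components and their greedy embedding *)

Definition adj_closed (T : finType) (e : rel T) (S : {set T}) : bool :=
  [forall u in S, forall v, e u v ==> (v \in S)].

Lemma adj_closedP (T : finType) (e : rel T) (S : {set T}) :
  reflect (forall u v, u \in S -> e u v -> v \in S) (adj_closed e S).
Proof.
apply: (iffP forall_inP) => H u; first by move=> v uS; move/forallP/(_ v)/implyP: (H u uS).
by move=> uS; apply/forallP => v; apply/implyP; apply: H.
Qed.

Lemma deg_in_split (T : finType) (e : rel T) (A B : {set T}) x :
  B \subset A -> deg_in e A x = deg_in e B x + deg_in e (A :\: B) x.
Proof.
move=> BA; rewrite /deg_in (big_setID B) /=; congr (_ + _).
by rewrite (setIidPr BA).
Qed.

Lemma deg_in_eq0 (T : finType) (e : rel T) (A : {set T}) x :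
  {in A, forall y, ~~ e x y} -> deg_in e A x = 0.
Proof. by move=> H; apply: big1 => y /H/negbTE->. Qed.

Lemma arcs_in_split (T : finType) (e : rel T) (A B : {set T}) :
  B \subset A -> {in B & A :\: B, forall x y, ~~ e x y && ~~ e y x} ->
  arcs_in e A = arcs_in e B + arcs_in e (A :\: B).
Proof.
move=> BA H; rewrite /arcs_in (big_setID B) (setIidPr BA) /=; congr (_ + _).
  apply: eq_bigr => x xB; rewrite (deg_in_split _ _ BA).
  rewrite [X in _ + X]deg_in_eq0 ?addn0 // => y yA.
  by have /andP[] := H x y xB yA.
apply: eq_bigr => x xA; rewrite (deg_in_split _ _ BA).
by rewrite deg_in_eq0 // => y yB; have /andP[] := H y x yB xA.
Qed.

Lemma arcs_in_closedC (T : finType) (e : rel T) (S : {set T}) :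
  symmetric e -> adj_closed e S -> arcs e = arcs_in e S + arcs_in e (~: S).
Proof.
move=> symE /adj_closedP clS; rewrite -arcs_inT -setTD.
apply: arcs_in_split; first exact: subsetT.
move=> x y xS; rewrite setTD inE symE andbb => yS.
by rewrite symE; apply: contra yS; apply: clS.
Qed.

(** Acyclicity of [S] is stated as 1-degeneracy, the form used by [greedy_embedding]. Take [S]
    minimal among closed sets with fewer edges than vertices. If some [A] violated degeneracy, a
    maximal [B] between [A] and [S] with at least as many edges as vertices would absorb every
    vertex adjacent to it. Then [S :\: B] would be a smaller closed set with fewer edges than
    vertices. *)
Lemma tree_component (T : finType) (e : rel T) :
  simple_graph e -> arcs e < 2 * #|T| ->
  exists S : {set T}, [/\ 0 < #|S|, adj_closed e S
    & forall A : {set T}, A \subset S -> 0 < #|A| ->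
        exists2 x, x \in A & deg_in e A x <= 1].
Proof.
move=> sE hT; have [symE irrE] := sE.
pose P (S : {set T}) := adj_closed e S && (arcs_in e S < 2 * #|S|).
have PT : P setT.
  rewrite /P arcs_inT cardsT hT andbT.
  by apply/adj_closedP => u v _ _; rewrite inE.
have [S /andP[/adj_closedP clS hS] Smin] := @arg_minnP _ setT P (fun S => #|S|) PT.
exists S; split; [by lia | exact/adj_closedP |].
move=> A AS A0; have [/exists_inP[x xA dx]|H] := boolP [exists x in A, deg_in e A x <= 1].
  by exists x.
exfalso; have {}H : 2 * #|A| <= arcs_in e A.
  rewrite mulnC -sum_nat_const; apply: leq_sum => x xA.
  by rewrite ltnNge; apply: contra H => dx; apply/exists_inP; exists x.
pose Q (B : {set T}) := [&& A \subset B, B \subset S & 2 * #|B| <= arcs_in e B].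
have QA : Q A by rewrite /Q subxx AS.
have [B /and3P[AB BS hB] Bmax] := @arg_maxnP _ A Q (fun S => #|S|) QA.
have B0 := leq_trans A0 (subset_leq_card AB).
have noedge : {in B & S :\: B, forall x y, ~~ e x y && ~~ e y x}.
  move=> x y xB; rewrite inE [e y x]symE andbb => /andP[yB yS].
  apply/negP => xy; have yI : y \in y |: B by apply: setU11.
  have yBK : (y |: B) :\ y = B by rewrite setU1K.
  have : Q (y |: B).
    rewrite /Q (subset_trans AB (subsetUr _ _)) subUset sub1set yS BS /=.
    rewrite (arcs_inD1 sE yI) yBK cardsU1 yB (deg_inD1 _ _ yI) yBK.
    by rewrite (deg_inD1 _ _ xB) symE xy; lia.
  by move/Bmax; rewrite cardsU1 yB /= add1n ltnn.
have split := arcs_in_split BS noedge.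
have cSB : #|S :\: B| = #|S| - #|B| by rewrite cardsD (setIidPr BS).
have leBS := subset_leq_card BS.
have : P (S :\: B).
  apply/andP; split; last by rewrite cSB; lia.
  apply/adj_closedP => u v; rewrite !inE => /andP[uB uS] uv.
  rewrite (clS u) // andbT; apply: contra uB => vB.
  have : ~~ (u \in S :\: B).
    by apply/negP => uSB; have := noedge v u vB uSB; rewrite uv andbF.
  by rewrite inE uS andbT negbK.
by move/Smin; rewrite cSB; lia.
Qed.

(** A smallest nonempty set of average degree at least [D] works: removing a vertex of degree below
    [D / 2] would keep the average. *)
Lemma min_degree_core (R : realFieldType) (T : finType) (e : rel T) (D : R) :
  simple_graph e -> 0 < #|T| -> (0 < D -> D * #|T|%:R <= (arcs e)%:R ->
  exists U : {set T}, (0 < #|U|)%N /\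
    {in U, forall x, D <= 2%:R * (deg_in e U x)%:R})%R.
Proof.
move=> sE T0 D0 hD; have [symE irrE] := sE.
pose P (U : {set T}) := (0 < #|U|) && (D * #|U|%:R <= (arcs_in e U)%:R)%R.
have PT : P setT by rewrite /P cardsT T0 arcs_inT.
have [U /andP[U0 hU0] Umin] := @arg_minnP _ setT P (fun S => #|S|) PT.
exists U; split=> // x xU; rewrite leNgt; apply/negP => dx.
have cU := cardsD1 x U; rewrite xU add1n in cU.
have aU := arcs_inD1 sE xU.
have : P (U :\ x).
  rewrite /P; move: (hU0); rewrite cU aU -addn1 [X in (_ <= X)%R]natrD natrM.
  rewrite natrD mulrDr mulr1 => hU.
  have le : (D * #|U :\ x|%:R <= (arcs_in e (U :\ x))%:R)%R.
    move: hU dx; set X := (2%:R * _)%R; set Y := (D * _)%R => hU dx; lra.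
  rewrite le andbT lt0n; apply/negP => /eqP c0.
  have xe : U = [set x].
    by apply/setP => z; have := in_set0 z; rewrite -(cards0_eq c0) !inE;
      case: eqP => [->|] //=.
  move: hU0; rewrite xe cards1 mulr1 /arcs_in big_set1 /deg_in big_set1 irrE.
  by rewrite leNgt D0.
by move/Umin; rewrite cU ltnn.
Qed.

(** Vertices are peeled off at degree at most 1 and embedded in the reverse order, so each new
    vertex has at most one neighbour already placed. *)
Lemma greedy_embedding (TH T : finType) (eH : rel TH) (e : rel T)
    (S : {set TH}) (U : {set T}) :
  simple_graph eH -> symmetric e ->
  (forall A : {set TH}, A \subset S -> 0 < #|A| ->
     exists2 x, x \in A & deg_in eH A x <= 1) ->
  0 < #|U| -> {in U, forall x, #|S| <= deg_in e U x} ->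
  exists f : TH -> T, {in S &, injective f} /\
    {in S &, forall u v, eH u v -> e (f u) (f v)}.
Proof.
move=> [symH irrH] symE degen U0 hU.
suff : forall n (A : {set TH}), #|A| = n -> A \subset S ->
    exists f : TH -> T, [/\ {in A, forall u, f u \in U}, {in A &, injective f}
      & {in A &, forall u v, eH u v -> e (f u) (f v)}].
  by move=> /(_ _ S erefl (subxx _))[f [_ finj fhom]]; exists f.
have /card_gt0P[w0 w0U] := U0.
elim=> [|n IH] A cA AS.
  by exists (fun=> w0); rewrite (cards0_eq cA); split=> u; rewrite inE.
have [|x xA dx] := degen A AS; first by rewrite cA.
have cAx : #|A :\ x| = n by have := cardsD1 x A; rewrite xA cA => -[].
have [f [fU finj fhom]] := IH _ cAx (subset_trans (subsetDl _ _) AS).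
(* [w] is the image of the only placed neighbour of [x], or an arbitrary vertex of [U] if there is
   none. *)
have [w wU hw] : exists2 w, w \in U & {in A :\ x, forall y, eH x y -> f y = w}.
  have [/exists_inP[y yA xy]|H] := boolP [exists y in A :\ x, eH x y]; last first.
    exists w0 => // y yA xy; case/negP: H; apply/exists_inP; by exists y.
  exists (f y); first exact: fU.
  move=> z zA xz; congr f; move: dx; rewrite deg_inE => /card_le1_eqP; apply.
    by move: yA; rewrite !inE xy => /andP[_ ->].
  by move: zA; rewrite !inE xz => /andP[_ ->].
(* Fewer than [#|S|] vertices are occupied, so some neighbour of [w] in [U] is free. *)
have /subsetPn[z] : ~~ ([set y in U | e w y] \subset f @: (A :\ x)).
  apply/negP => /subset_leq_card H.
  have := leq_imset_card f (A :\ x); have := subset_leq_card AS.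
  by have := hU w wU; rewrite deg_inE; lia.
rewrite inE => /andP[zU wz] zf.
have memAx u : u \in A -> u != x -> u \in A :\ x by rewrite !inE => -> ->.
have fz u : u \in A -> u != x -> f u != z.
  move=> uA ux; apply: contraNneq zf => <-; apply: imset_f; exact: memAx.
exists (fun u => if u == x then z else f u); split.
- by move=> u uA; case: eqVneq => // ux; apply/fU/memAx.
- move=> u v uA vA; case: (eqVneq u x) => [->|ux]; case: (eqVneq v x) => [->|vx] //.
  + by move=> E; have := fz v vA vx; rewrite -E eqxx.
  + by move=> E; have := fz u uA ux; rewrite E eqxx.
  + by apply: finj; apply: memAx.
- move=> u v uA vA; case: (eqVneq u x) => [->|ux]; case: (eqVneq v x) => [->|vx].
  + by rewrite irrH.
  + by move/hw => ->; rewrite 1?symE // memAx.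
  + by rewrite symH => /hw ->; rewrite // memAx.
  + by apply: fhom; apply: memAx.
Qed.

(** No edge of [H] leaves [S], so the copy of [S] under [f] combines freely with a model of the rest
    that avoids this copy. *)
Lemma minor_of_deleted (TH T : finType) (eH : rel TH) (e : rel T)
    (S : {set TH}) (f : TH -> T) :
  symmetric eH -> adj_closed eH S -> {in S &, injective f} ->
  {in S &, forall u v, eH u v -> e (f u) (f v)} ->
  is_minor (induced eH (~: S)) (induced e (~: (f @: S))) -> is_minor eH e.
Proof.
move=> symH /adj_closedP clS finj fhom [psi [psi0 psiD psiC psiE]].
pose phi u : {set T} :=
  if (insub u : option {x | x \in ~: S}) is Some u' then \bigcup_(w in psi u') [set val w]
  else [set f u].
have phiS u : u \in S -> phi u = [set f u].
  by move=> uS; rewrite /phi insubF // inE uS.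
have phiN u (uS : u \in ~: S) : phi u = \bigcup_(w in psi (Sub u uS)) [set val w].
  by rewrite /phi insubT.
have disj u v : u \in S -> v \in ~: S -> [disjoint phi u & phi v].
  move=> uS vS; rewrite phiS // (phiN _ vS) disjoints1.
  apply/negP => /bigcupP[w _ /set1P fw]; have := valP w.
  by rewrite -fw inE imset_f.
exists phi; split.
- move=> u; apply/set0Pn; have [uS|uS] := boolP (u \in S).
    by exists (f u); rewrite phiS ?set11.
  rewrite -in_setC in uS; have /set0Pn[w wu] := psi0 (Sub u uS).
  by exists (val w); rewrite (phiN _ uS); apply/bigcupP; exists w; rewrite ?set11.
- move=> u v uv; have [uS|uS] := boolP (u \in S); have [vS|vS] := boolP (v \in S).
  + rewrite !phiS // disjoints1 inE; apply: contra uv => /eqP.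
    by move/(finj _ _ uS vS)->.
  + by apply: disj; rewrite ?inE.
  + by rewrite disjoint_sym; apply: disj; rewrite ?inE.
  + rewrite -!in_setC in uS vS; rewrite (phiN _ uS) (phiN _ vS).
    have uv' : Sub u uS != Sub v vS :> {x | x \in ~: S} by rewrite -val_eqE.
    apply/pred0P => z /=; apply/negbTE/negP => /andP[/bigcupP[w wu /set1P->]].
    move=> /bigcupP[w' w'v /set1P/val_inj ww']; subst w'.
    by have := disjointFr (psiD _ _ uv') wu; rewrite w'v.
- move=> u; have [uS|uS] := boolP (u \in S).
    by rewrite phiS //; apply: connected_in1.
  rewrite -in_setC in uS; rewrite (phiN _ uS).
  apply: connected_in_bigcup (psiC _) => [w|w w' ww']; first exact: connected_in1.
  by exists (val w), (val w'); rewrite !set11.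
- move=> u v uv; have [uS|uS] := boolP (u \in S).
    have vS := clS _ _ uS uv; exists (f u), (f v); rewrite !phiS // !set11.
    by split=> //; apply: fhom.
  have vS : v \notin S by apply: contra uS => vS; apply: clS vS _; rewrite symH.
  rewrite -!in_setC in uS vS; rewrite (phiN _ uS) (phiN _ vS).
  have [w [w' [wu w'v ww']]] := psiE (Sub u uS) (Sub v vS) uv.
  exists (val w), (val w'); split=> //; apply/bigcupP;
    [exists w | exists w'] => //; exact: set11.
Qed.

(** At most [#|X| * #|T|] arcs start in [X], and at most [#|~: X| * #|X|] others end there. *)
Lemma leq_arcs_in_setC (T : finType) (e : rel T) (X : {set T}) :
  arcs e + #|X| * #|X| <= arcs_in e (~: X) + 2 * #|X| * #|T|.
Proof.
have deg_le (A : {set T}) x : deg_in e A x <= #|A|.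
  by rewrite -sum1_card; apply: leq_sum => y _; case: (e x y).
have out : \sum_(x in ~: X) deg e x <= #|~: X| * #|X| + arcs_in e (~: X).
  rewrite -sum_nat_const -big_split /=; apply: leq_sum => x _.
  by rewrite -deg_inT (deg_in_split _ _ (subsetT X)) setTD leq_add2r.
have inn : \sum_(x in X) deg e x <= #|X| * #|T|.
  by rewrite -sum_nat_const; apply: leq_sum => x _; rewrite -deg_inT -cardsT.
have -> : arcs e = \sum_(x in X) deg e x + \sum_(x in ~: X) deg e x.
  rewrite /arcs (bigID (mem X)) /=; congr (_ + _).
  by apply: eq_bigl => x; rewrite !inE.
have := cardsC X; nia.
Qed.

(** * Random placement of the vertices of [H] *)

Lemma perm_two_points (T : finType) (a b a' b' : T) :
  a != b -> a' != b' -> exists s : {perm T}, s a = a' /\ s b = b'.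
Proof.
move=> ab ab'; exists (tperm a a' * tperm (tperm a a' b) b')%g.
have ba : tperm a a' b != a' by rewrite -{2}(tpermL a a') (inj_eq perm_inj) eq_sym.
by rewrite !permM !tpermL tpermD // eq_sym.
Qed.

(* The left-hand sum does not depend on the pair [(a, b)], as the symmetric
   group is 2-transitive. *)
Lemma sum_perm_pair (T : finType) (F : T -> T -> nat) (a b : T) : a != b ->
  (\sum_(s : {perm T}) F (s a) (s b)) * (#|T| * #|T|.-1)
  = #|{perm T}| * \sum_x \sum_(y | y != x) F x y.
Proof.
move=> ab.
have const x y : y != x ->
    \sum_(s : {perm T}) F (s x) (s y) = \sum_(s : {perm T}) F (s a) (s b).
  rewrite eq_sym => xy; have [s [sa sb]] := perm_two_points ab xy.
  rewrite [RHS](reindex_inj (mulgI s)) /=.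
  by apply: eq_bigr => s' _; rewrite !permM sa sb.
transitivity (\sum_x \sum_(y | y != x) \sum_(s : {perm T}) F (s x) (s y)).
  rewrite mulnC -mulnA -sum_nat_const; apply: eq_bigr => x _.
  rewrite (eq_bigr _ (const x)) sum_nat_const; congr (_ * _).
  by rewrite -(cardC1 x); apply: eq_card => y; rewrite !inE.
under eq_bigr => x _ do rewrite exchange_big /=.
rewrite exchange_big /= -sum_nat_const; apply: eq_bigr => s _.
rewrite [RHS](reindex_inj (@perm_inj _ s)) /=; apply: eq_bigr => x _.
rewrite [RHS](reindex_inj (@perm_inj _ s)) /=; apply: eq_bigl => y.
by rewrite (inj_eq perm_inj).
Qed.

Definition missing_arcs (TH T : finType) (eH : rel TH) (e : rel T) (f : TH -> T) : nat :=
  \sum_u \sum_(v | eH u v) ~~ e (f u) (f v).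

(** Compose a fixed injection with a uniform permutation of [T]. A vertex has at most [r]
    non-neighbours among the [k] others, so an arc of [H] is missed with probability at most
    [r / k]; some permutation does no worse than the mean. *)
Lemma few_missing (TH T : finType) (eH : rel TH) (e : rel T) k r :
  simple_graph eH -> #|T| = k.+1 -> #|TH| <= k.+1 -> irreflexive e ->
  (forall x, k <= deg e x + r) ->
  exists2 f : TH -> T, injective f & missing_arcs eH e f * k <= arcs eH * r.
Proof.
move=> [symH irrH] cT cH irrE hdeg.
have [i iinj] : exists i : TH -> T, injective i.
  have le : #|TH| <= #|T| by rewrite cT.
  exists (fun u => enum_val (widen_ord le (enum_rank u))) => u v /enum_val_inj.
  by move/(congr1 val) => /= uv; apply/enum_rank_inj/val_inj.
pose cost (s : {perm T}) := missing_arcs eH e (s \o i).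
have pairs : \sum_x \sum_(y | y != x) ~~ e x y <= #|T| * r.
  rewrite -sum_nat_const; apply: leq_sum => x _.
  rewrite -(leq_add2l (deg e x)); apply: leq_trans (hdeg x).
  rewrite /deg (bigD1 x) //= irrE add0n -big_split /=.
  rewrite (eq_bigr (fun=> 1)); last by move=> y _; case: (e x y).
  by rewrite sum1_card cardC1 cT.
have total : (\sum_s cost s) * k <= #|{perm T}| * (arcs eH * r).
  rewrite /cost /missing_arcs exchange_big /= mulnA [_ * arcs eH]mulnC.
  rewrite -mulnA /arcs !big_distrl /=; apply: leq_sum => u _.
  rewrite exchange_big /= /deg !big_distrl /= big_mkcond /=.
  apply: leq_sum => v _; case: ifP => uv; rewrite ?mul1n // ?mul0n //.
  have iuv : i u != i v.
    by rewrite (inj_eq iinj); apply: contraTneq uv => ->; rewrite irrH.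
  have := sum_perm_pair (fun x y => ~~ e x y : nat) iuv; rewrite cT /= => E.
  rewrite -(leq_pmul2l (ltn0Sn k)) mulnCA E mulnCA leq_mul2l.
  by rewrite -cT pairs orbT.
have [s _ smin] := @arg_minnP {perm T} 1%g xpredT cost isT.
exists (s \o i); first exact: inj_comp perm_inj iinj.
have P0 : 0 < #|{perm T}| by apply/card_gt0P; exists 1%g.
rewrite -(leq_pmul2l P0); apply: leq_trans total; rewrite mulnA leq_mul2r.
by rewrite -sum_nat_const leq_sum ?orbT // => s' _; apply: smin.
Qed.

(** * Joining the missing pairs by paths of length two *)

(** Both neighbourhoods have at least [k - r] elements and lie among the [k - 1] vertices other than
    [a] and [b]; apply inclusion-exclusion. *)
Lemma common_nbrs (T : finType) (e : rel T) k r a b :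
  simple_graph e -> #|T| = k.+1 -> (forall x, k <= deg e x + r) ->
  a != b -> ~~ e a b -> k.+1 <= #|[set x | e a x & e x b]| + r.*2.
Proof.
move=> [symE irrE] cT hdeg ab nab.
have -> : [set x | e a x & e x b] = [set x | e a x] :&: [set x | e b x].
  by apply/setP => x; rewrite !inE [e x b]symE.
have := cardsUI [set x | e a x] [set x | e b x]; rewrite -!degE.
have : #|[set x | e a x] :|: [set x | e b x]| <= #|~: [set a; b]|.
  apply/subset_leq_card/subsetP => x; rewrite !inE.
  by apply: contraTN => /orP[]/eqP->; rewrite !irrE ?orbF //= symE.
have := cardsC [set a; b]; rewrite cards2 ab cT.
have := hdeg a; have := hdeg b; lia.
Qed.

Lemma connect_pairs (TH T : finType) (e : rel T) (f : TH -> T) c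
    (L : seq (TH * TH)) :
  simple_graph e -> injective f ->
  {in L, forall p, p.1 != p.2 /\ c <= #|[set x | e (f p.1) x & e x (f p.2)]|} ->
  #|TH| + size L <= c + 2 ->
  exists phi : TH -> {set T},
    [/\ forall u, f u \in phi u,
        forall u v, u != v -> [disjoint phi u & phi v],
        forall u, {in phi u, forall x, x = f u \/ e (f u) x},
        {in L, forall p, exists2 x, x \in phi p.1 & e x (f p.2)}
      & #|\bigcup_u phi u| <= #|TH| + size L].
Proof.
move=> [symE irrE] finj; elim: L => [|[u v] L IH] hL hc.
  exists (fun u => [set f u]); split=> //.
  - by move=> u; rewrite inE.
  - by move=> u v uv; rewrite disjoints1 inE (inj_eq finj).
  - by move=> u x /set1P->; left.
  - rewrite addn0 -(card_codom finj); apply/subset_leq_card/subsetP => x.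
    by case/bigcupP => u _ /set1P->; apply: codom_f.
case: IH => [p pL||phi [phif phiD phiS phiL phiU]].
- by apply: hL; rewrite inE pL orbT.
- by move: hc => /=; lia.
have [/= uv hcommon] := hL (u, v) (mem_head _ _).
set U := \bigcup_u phi u in phiU.
have fU w : f w \in U by apply/bigcupP; exists w.
(* The endpoints [f u] and [f v] are occupied but are not common neighbours of themselves; this
   saving is the [2] in [c + 2]. *)
have /subsetPn[x] : ~~ ([set x | e (f u) x & e x (f v)] \subset U :\: [set f u; f v]).
  apply/negP => /subset_leq_card /(leq_trans hcommon); rewrite cardsD.
  rewrite (setIidPr _) ?cards2 ?(inj_eq finj) ?uv; last first.
    by apply/subsetP => z; rewrite !inE => /orP[]/eqP->.
  have : 1 < #|U|.
    rewrite (cardD1 (f u)) fU (cardD1 (f v)) !inE fU (inj_eq finj) eq_sym uv //.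
  by move: hc phiU; move: #|U| => /= n; lia.
rewrite !inE => /andP[ux xv]; rewrite negb_and negbK.
have -> : (x == f u) || (x == f v) = false.
  by apply/negbTE; rewrite negb_or; apply/andP; split;
    [apply: contraTneq ux | apply: contraTneq xv] => ->; rewrite irrE.
move=> /= xU.
have xphi w : x \notin phi w by apply: contra xU => xw; apply/bigcupP; exists w.
exists (fun w => if w == u then x |: phi u else phi w); split.
- by move=> w; case: eqP => [->|_]; rewrite ?inE phif ?orbT.
- move=> w w' ww'; case: (eqVneq w u) => [wu|wu]; case: (eqVneq w' u) => [w'u|w'u].
  + by rewrite wu w'u eqxx in ww'.
  + rewrite disjoints_subset subUset sub1set inE xphi -disjoints_subset phiD //.
    by rewrite eq_sym.
  + rewrite disjoint_sym disjoints_subset subUset sub1set inE xphi.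
    by rewrite -disjoints_subset phiD // eq_sym.
  + exact: phiD.
- move=> w y; case: eqP => [->|_]; last exact: phiS.
  by rewrite inE => /orP[/set1P->|/phiS //]; right.
- move=> [a b]; rewrite inE => /orP[/eqP[-> ->]|/phiL[y /= ya yb]] /=.
    by exists x; rewrite ?eqxx // !inE eqxx.
  by exists y => //; case: eqP => [<-|//]; rewrite inE ya orbT.
- rewrite /= addnS; apply: leq_trans (_ : #|x |: U| <= _).
    apply/subset_leq_card/subsetP => y /bigcupP[w _]; rewrite inE.
    case: eqP => _; last by move=> yw; apply/orP; right; apply/bigcupP; exists w.
    by rewrite !inE => /orP[->//|yw]; apply/orP; right; apply/bigcupP; exists u.
  by rewrite cardsU1 xU.
Qed.

Lemma dense_graph_minor (TH T : finType) (eH : rel TH) (e : rel T) k r :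
  simple_graph eH -> simple_graph e ->
  #|T| = k.+1 -> #|TH| <= k.+1 -> (forall x, k <= deg e x + r) ->
  (forall s, 2 * s * k <= arcs eH * r -> #|TH| + s + r.*2 <= k + 3) ->
  is_minor eH e.
Proof.
move=> sH sE cT cH hdeg hs; have [symH irrH] := sH; have [symE irrE] := sE.
have [f finj fmiss] := few_missing sH cT cH irrE hdeg.
pose bad u v := eH u v && ~~ e (f u) (f v).
(* Ordering by [enum_rank] lists each missing edge once, whereas [missing_arcs] counts it twice. *)
pose L := [seq p <- enum {: TH * TH} | bad p.1 p.2 && (enum_rank p.1 < enum_rank p.2)].
have sizeL : missing_arcs eH e f = 2 * size L.
  rewrite /missing_arcs; have -> : \sum_u \sum_(v | eH u v) ~~ e (f u) (f v) =
      \sum_(p : TH * TH | bad p.1 p.2) 1.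
    rewrite [RHS]big_mkcond /=.
    rewrite -(pair_bigA _ (fun u v => if bad u v then 1 else 0)) /=.
    apply: eq_bigr => u _; rewrite big_mkcond /=; apply: eq_bigr => v _.
    by rewrite /bad; case: (eH u v); case: (e _ _).
  rewrite (bigID (fun p : TH * TH => enum_rank p.1 < enum_rank p.2)) /=.
  have -> : size L = \sum_(p : TH * TH | bad p.1 p.2 && (enum_rank p.1 < enum_rank p.2)) 1.
    rewrite sum1_card cardE /enum_mem; congr (size _).
    by rewrite /L enumT; apply: eq_filter.
  rewrite mul2n -addnn; congr (_ + _).
  rewrite (reindex_inj (inv_inj (@swap_pairK TH TH))) /=.
  apply: eq_bigl => -[u v] /=; rewrite /bad symH symE -leqNgt.
  case: (eqVneq u v) => [->|uv]; first by rewrite irrH.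
  by rewrite leq_eqVlt val_eqE (inj_eq enum_rank_inj) (negbTE uv).
have {}hs := hs (size L); rewrite -sizeL in hs; have {}hs := hs fmiss.
have [||phi [phif phiD phiS phiL _]] :=
  @connect_pairs TH T e f (k.+1 - r.*2) L sE finj.
- move=> p; rewrite mem_filter => /andP[/andP[/andP[h1 h2] _] _].
  have p12 : p.1 != p.2 by apply: contraTneq h1 => ->; rewrite irrH.
  split=> //; rewrite leq_subLR addnC; apply: common_nbrs h2 => //.
  by rewrite (inj_eq finj).
- lia.
exists phi; split=> // [u|u|u v uv].
- by apply/set0Pn; exists (f u).
- exact: connected_in_star symE (phif u) (phiS u).
- have [fuv|fuv] := boolP (e (f u) (f v)); first by exists (f u), (f v).
  have [lt|gt|eq] := ltngtP (enum_rank u) (enum_rank v).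
  + have /phiL[x xu xv] : (u, v) \in L by rewrite mem_filter /bad /= uv fuv lt mem_enum.
    by exists x, (f v).
  + have /phiL[x xv xu] : (v, u) \in L.
      by rewrite mem_filter /bad /= symH uv symE fuv gt mem_enum.
    by exists (f u), x; rewrite symE.
  + by move: uv; rewrite (enum_rank_inj (val_inj eq)) irrH.
Qed.

Local Open Scope ring_scope.

(** * From average degree to minimum degree *)

(** With [x] half the current average degree [D'], a reduction removes one vertex and at most [D']
    arcs, so the average does not drop. When no reduction is left, the closed neighbourhood serves.
    [D'] is recomputed at each stage so that it also bounds the size. *)
Lemma half_degree_minor (R : realFieldType) n : forall (T : finType) (e : rel T) (D : R),
  #|T| = n.+1 -> simple_graph e -> D * #|T|%:R <= (arcs e)%:R ->
  exists (W : finType) (eW : rel W) (D' : R),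
    [/\ simple_graph eW, is_minor eW e, D <= D', (0 < #|W|)%N
      & #|W|%:R - 1 <= D' /\ forall y, D' / 2%:R <= (deg eW y)%:R].
Proof.
elim: n => [|n IH] T e D cT sE hD.
  have a0 : arcs e = 0%N by have := leq_arcs_card (proj2 sE); rewrite cT; lia.
  exists T, e, 0; split=> //; rewrite ?cT //.
  - exact: is_minor_refl.
  - by move: hD; rewrite cT a0 mulr1.
  - by rewrite subrr mul0r; split.
pose D' : R := (arcs e)%:R / #|T|%:R.
have T0 : (0 < #|T|%:R :> R) by rewrite cT ltr0n.
have D'E : D' * #|T|%:R = (arcs e)%:R by rewrite /D' divfK // gt_eqF.
have DD' : D <= D' by rewrite /D' ler_pdivlMr.
case: (@closed_nbhd_or_smaller_minor R T e (D' / 2%:R)) => //.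
- by rewrite cT.
- case=> [T' [e' [sE' cT' mE' aE']]].
  case: (IH T' e' D'); rewrite ?cT' ?cT //.
    by move: D'E aE'; rewrite cT /= -[n.+2]addn1 natrD => D'E; lra.
  move=> W [eW [D2 [sW mW D2D W0 H]]]; exists W, eW, D2; split=> //.
    exact: is_minor_trans mE'.
  exact: le_trans D2D.
- case=> S [S0 Sc Sd]; exists {x | x \in S}, (induced e S), D'.
  rewrite card_induced; split=> //.
  + exact: induced_simple.
  + exact: induced_minor.
  + split; last by move=> y; rewrite deg_induced; apply: Sd; apply: valP.
    rewrite ler_pdivlMr // -(ler_nat R) natrM in Sc *.
    by apply: le_trans Sc; rewrite -subn1 natrB.
Qed.

Lemma delete_edge (T : finType) (e : rel T) :
  simple_graph e -> (0 < arcs e)%N ->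
  exists e' : rel T, [/\ simple_graph e', is_minor e' e & arcs e = (arcs e' + 2)%N].
Proof.
move=> [symE irrE]; rewrite lt0n sum_nat_eq0 => /forallPn[x].
rewrite sum_nat_eq0 => /forallPn[y]; rewrite /= eqb0 negbK => xy.
have xNy : x != y by apply: contraTneq xy => ->; rewrite irrE.
pose e' a b := [&& e a b, (a, b) != (x, y) & (a, b) != (y, x)].
exists e'; split.
- split=> [a b|a]; last by rewrite /e' irrE.
  rewrite /e' !xpair_eqE (symE a b) andbC ![(a == _) && _]andbC andbC.
  by congr (_ && _); rewrite andbC.
- by apply: is_minor_subrel => a b /and3P[].
- have sing u v : (\sum_a \sum_b ((a, b) == (u, v) :> T * T : nat) = 1)%N.
    rewrite (pair_bigA _ (fun a b => ((a, b) == (u, v) : nat))) /=.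
    rewrite (bigD1 (u, v)) //= eqxx big1 // => -[a b] /=.
    by move/negbTE->.
  rewrite -[2%N]/(1 + 1)%N -{1}(sing x y) -(sing y x) /arcs /deg -!big_split /=.
  apply: eq_bigr => a _; rewrite -!big_split /=; apply: eq_bigr => b _.
  rewrite /e'; case: (eqVneq (a, b) (x, y)) => [[-> ->]|_] /=.
    by rewrite xpair_eqE (negbTE xNy) xy.
  by case: (eqVneq (a, b) (y, x)) => [[-> ->]|_] /=;
    rewrite ?andbF ?andbT ?addn0 // symE xy.
Qed.

(** * Logarithm estimates and the arc threshold *)

Lemma ln5_le (R : realType) : ln (5%:R : R) <= 162%:R / 100%:R.
Proof.
have le5 : (5%:R : R) <= (101%:R / 100%:R) ^+ 162.
  set a : R := 101%:R / 100%:R.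
  (* Repeated squaring, rounding down at each stage, keeps the numerals small. *)
  have sq (c c' : R) n : 0 <= c -> c' <= c * c -> c <= a ^+ n -> c' <= a ^+ (n + n).
    by move=> c0 cc H; rewrite exprD; apply: le_trans cc _; apply: ler_pM.
  have p4 : 10406%:R / 10000%:R <= a ^+ 4 by rewrite !exprS expr0 /a; lra.
  have p5 : 10510%:R / 10000%:R <= a ^+ 5 by rewrite exprS /a; lra.
  have p10 : 11046%:R / 10000%:R <= a ^+ 10 by apply: sq p5; lra.
  have p20 : 12201%:R / 10000%:R <= a ^+ 20 by apply: sq p10; lra.
  have p40 : 14886%:R / 10000%:R <= a ^+ 40 by apply: sq p20; lra.
  have p80 : 22159%:R / 10000%:R <= a ^+ 80 by apply: sq p40; lra.
  have p81 : 22380%:R / 10000%:R <= a ^+ 81 by rewrite exprS /a; lra.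
  by apply: sq p81; lra.
apply: (le_trans (y := ln ((101%:R / 100%:R : R) ^+ 162))).
  by rewrite ler_ln ?posrE ?exprn_gt0; [exact: le5 | lra..].
rewrite lnXn; last by lra.
have -> : 101%:R / 100%:R = 1 + 1 / 100%:R :> R by lra.
have : ln (1 + 1 / 100%:R : R) <= 1 / 100%:R by apply: le_ln1Dx; lra.
by rewrite -[_ *+ 162]mulr_natr; lra.
Qed.

(* The tangent at 5 is accurate where density_gap needs it, near [2 d / z = 5]. *)
Lemma ln_tangent5 (R : realType) (u : R) : 0 < u ->
  ln u <= 62%:R / 100%:R + u / 5%:R.
Proof.
move=> u0; have -> : u = 5%:R * (1 + (u / 5%:R - 1)) by field.
rewrite lnM ?posrE; [|lra|lra].
have := @le_ln1Dx R (u / 5%:R - 1); have := ln5_le R => H1 H2.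
by have {}H2 : ln (1 + (u / 5%:R - 1)) <= u / 5%:R - 1; [apply: H2|]; lra.
Qed.

(* With [z = m - 1]: no graph reaching the threshold has [m - 1] in the window
   [0.315 d .. 0.461 d], and as the window is longer than 1, removing
   vertices one at a time cannot jump over it. *)
Lemma density_gap (R : realType) (d z : R) :
  0 < d -> 63%:R / 200%:R * d <= z ->
  d * (1 - 362%:R / 1000%:R * ln (2%:R * d / z)) <= z ->
  461%:R / 1000%:R * d <= z.
Proof.
move=> d0 zlo H; have z0 : 0 < z by lra.
have u0 : 0 < 2%:R * d / z by rewrite divr_gt0 //; lra.
have L := ln_tangent5 u0.
set y := z / d; have zE : z = y * d by rewrite /y divfK // gt_eqF.
have y0 : 0 < y by rewrite /y divr_gt0.
have uE : 2%:R * d / z = 2%:R / y by rewrite zE; field; rewrite !gt_eqF.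
rewrite uE in L H.
have ylo : 63%:R / 200%:R <= y by rewrite zE ler_pM2r in zlo.
have {}H : 1 - 362%:R / 1000%:R * ln (2%:R / y) <= y.
  by rewrite -(ler_pM2l d0) [d * y]mulrC -zE.
have {H L}H : 1 - 362%:R / 1000%:R * (62%:R / 100%:R + 2%:R / y / 5%:R) <= y by lra.
have {}H : y - 362%:R / 1000%:R * (62%:R / 100%:R * y + 2%:R / 5%:R) <= y * y.
  rewrite -subr_ge0
    (_ : _ - _ =
       y * (y - (1 - 362%:R / 1000%:R * (62%:R / 100%:R + 2%:R / y / 5%:R)))).
    by rewrite mulr_ge0 ?subr_ge0 // ltW.
  by field; rewrite gt_eqF.
rewrite zE ler_pM2r //.
(* By [H], [y ^ 2 - 0.77556 y + 0.1448] is nonnegative; its roots, about 0.3131 and 0.4624, enclose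
   the window. *)
by case: (lerP (461%:R / 1000%:R) y) => // yhi; nra.
Qed.

Lemma ln_increment (R : realType) (u z : R) : 0 < u -> 1 < z ->
  ln (u / z) + z^-1 <= ln (u / (z - 1)).
Proof.
move=> u0 z1.
have -> : u / z = u / (z - 1) * (1 + - z^-1) by field; rewrite !gt_eqF //; lra.
have iz : z^-1 < 1 by rewrite invf_lt1 //; lra.
rewrite lnM ?posrE; [|by rewrite divr_gt0 //; lra|lra].
have := @le_ln1Dx R (- z^-1); lra.
Qed.

(* The increments of [arc_threshold d m / m] are such that an edge whose
   contraction takes a graph below the threshold has enough common neighbours
   (arc_threshold_step).  The constant 0.362 must be below the root
   [b = 0.373] of [1 = b (1 + ln (2 / b))], for the process to stop
   (density_gap), and above [3 / 8.291] for room_for_subdivision. *)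
Definition arc_threshold (R : realType) (d m : R) : R :=
  m * (d * (1 - 362%:R / 1000%:R * ln (2%:R * d / (m - 1)))).

Lemma arc_threshold_le (R : realType) (d m : R) :
  0 < d -> 1 < m -> m - 1 <= 2%:R * d -> arc_threshold d m <= m * d.
Proof.
move=> d0 m1 md; have := @ln_ge0 R (2%:R * d / (m - 1)).
rewrite ler_pdivlMr ?mul1r; last lra.
move/(_ md); rewrite /arc_threshold; set l := ln _ => l0.
have : 0 <= m * d * l by rewrite !mulr_ge0 //; lra.
lra.
Qed.

(** By [ln_increment], the threshold per vertex falls by at least [0.362 d / (m - 1)] from [m] to
    [m - 1]. Over [m - 1] vertices this yields [0.362 d], and [a / m] is the share of the vertex
    that disappears. *)
Lemma arc_threshold_step (R : realType) (d m a : R) :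
  0 < d -> 2%:R < m -> arc_threshold d m <= a ->
  a / m + 362%:R / 1000%:R * d <= a - arc_threshold d (m - 1).
Proof.
move=> d0 m2.
have u0 : 0 < 2%:R * d by lra.
have := @ln_increment R (2%:R * d) (m - 1) u0 ltac:(lra).
rewrite /arc_threshold; set l := ln _; set l' := ln _; move=> incr ha.
have am : d * (1 - 362%:R / 1000%:R * l) <= a / m.
  by rewrite ler_pdivlMr ?[_ * m]mulrC //; lra.
have {}incr : 1 <= (m - 1) * (l' - l).
  have m10 : m - 1 != 0 by rewrite gt_eqF //; lra.
  apply: (le_trans (y := (m - 1) * (m - 1)^-1)); first by rewrite divff.
  by rewrite ler_pM2l; lra.
have -> : a = m * (a / m) by field; rewrite gt_eqF //; lra.
rewrite [m * (a / m) / m](_ : _ = a / m); last by field; rewrite gt_eqF //; lra.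
set r := a / m in am *.
have H1 : 0 <= (m - 1) * (r - d * (1 - 362%:R / 1000%:R * l)) by rewrite mulr_ge0; lra.
have H2 : 0 <= d * ((m - 1) * (l' - l) - 1) by rewrite mulr_ge0; lra.
lra.
Qed.

(** * The contraction process of Mader *)

(** Surplus edges are discarded so that the average degree stays close to the threshold; this is
    what bounds the closed neighbourhood in [dense_minor]. *)
Lemma trim_edges (R : realDomainType) (F : R) N :
  forall (T : finType) (e : rel T), (arcs e <= N)%N -> simple_graph e ->
  F <= (arcs e)%:R ->
  exists e' : rel T, [/\ simple_graph e', is_minor e' e, F <= (arcs e')%:R
    & arcs e' = 0%N \/ (arcs e')%:R < F + 2%:R].
Proof.
elim: N => [|N IH] T e hN sE hF.
  by exists e; split=> //; [apply: is_minor_refl | left; lia].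
have [del|ltF] := lerP (F + 2%:R) (arcs e)%:R; last first.
  by exists e; split=> //; [apply: is_minor_refl | right].
have [a0|a0] := posnP (arcs e).
  by exists e; split=> //; [apply: is_minor_refl | left].
have [e1 [s1 m1 a1]] := delete_edge sE a0.
case: (IH T e1) => //; first lia.
  by move: del; rewrite a1 natrD lerD2r.
by move=> e2 [s2 m2 *]; exists e2; split=> //; apply: is_minor_trans m1.
Qed.

Lemma dense_minor (R : realType) (d : R) n : 7%:R <= d ->
  forall (T : finType) (e : rel T), #|T| = n -> simple_graph e ->
  #|T|%:R - 1 <= 2%:R * d -> 63%:R / 200%:R * d <= #|T|%:R - 1 ->
  arc_threshold d #|T|%:R <= (arcs e)%:R ->
  exists (W : finType) (eW : rel W) (k : nat),
    [/\ simple_graph eW, is_minor eW e, #|W| = k.+1, k%:R <= d + 1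
      & forall y, k%:R + 362%:R / 1000%:R * d <= 2%:R * (deg eW y)%:R].
Proof.
move=> d7; elim: n => [|n IH] T e0 cT s0 mhi mlo ha0.
  by move: mlo; rewrite cT; lra.
have m2 : 2%:R < #|T|%:R :> R by lra.
have T0 : (0 < #|T|)%N by rewrite -(ltr_nat R); lra.
have [e [sE mE ha trim]] := trim_edges (leqnn _) s0 ha0.
suff [W [eW [k [sW mW *]]]] : exists (W : finType) (eW : rel W) (k : nat),
    [/\ simple_graph eW, is_minor eW e, #|W| = k.+1, k%:R <= d + 1
      & forall y, k%:R + 362%:R / 1000%:R * d <= 2%:R * (deg eW y)%:R].
  by exists W, eW, k; split=> //; apply: is_minor_trans mE.
have d0 : 0 < d by lra.
have H1 := arc_threshold_step d0 m2 ha.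
have H2 : arc_threshold d #|T|%:R <= #|T|%:R * d by apply: arc_threshold_le; lra.
(* One reduction may lose [2 x] arcs and still meet the threshold for one vertex fewer; by [H1],
   [2 x] is at least the average degree plus [0.362 d]. *)
pose x : R := ((arcs e)%:R - arc_threshold d (#|T|%:R - 1)) / 2%:R.
have mN : #|T|.-1%:R = #|T|%:R - 1 :> R by rewrite -subn1 natrB.
case: (@closed_nbhd_or_smaller_minor R T e x) => //.
- case=> [T' [e' [sE' cT' mE' aE']]].
  (* Since [0.461 d - 1 >= 0.315 d] for [d >= 7], the smaller graph still satisfies the lower bound
     on its size. *)
  have gap : 461%:R / 1000%:R * d <= #|T|%:R - 1.
    apply: density_gap => //.
    have := leq_arcs_card (proj2 sE); rewrite -(ler_nat R) natrM natrB //.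
    move=> /(le_trans ha); rewrite /arc_threshold ler_pM2l; [by []|lra].
  case: (IH T' e'); rewrite ?cT' ?mN //; [by rewrite cT|lra|lra| |].
    by move: aE'; rewrite /x mulrC divfK ?pnatr_eq0 //; lra.
  move=> W [eW [k [sW mW cW kd dW]]]; exists W, eW, k; split=> //.
  exact: is_minor_trans mE'.
- case=> S [S0 Sc Sd]; exists {x | x \in S}, (induced e S), #|S|.-1.
  rewrite card_induced prednK //.
  move: Sc; rewrite -(ler_nat R) natrM -ler_pdivlMr; last lra.
  move=> Sc; split=> //.
  + exact: induced_simple.
  + exact: induced_minor.
  + apply: le_trans Sc _; rewrite ler_pdivrMr; last lra.
    (* The trimmed graph has fewer than [m d + 2] arcs on [m > 2] vertices, hence average degree at
       most [d + 1]. *)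
    case: trim => [->|]; last by nra.
    by rewrite mulr_ge0; lra.
  + move=> y; rewrite deg_induced; have := Sd _ (valP y); rewrite /x => Hy; lra.
Qed.

(** * Graphs [H] with at least as many edges as vertices *)

(** Here [s] stands for the number of missing edges. To leading order the worst case is [t = q],
    [k = d], [2 d = 7.291 q], where the claim becomes [3 / 2 <= 0.362 * 8.291 / 2]. *)
Lemma room_for_subdivision (R : realFieldType) (t q d k s : R) :
  0 <= t -> t <= q -> t + 6291%:R / 1000%:R * q <= 2%:R * d ->
  0 < k -> k <= d + 1 -> s * (2%:R * k) <= q * (k - 362%:R / 1000%:R * d) ->
  t + s <= 362%:R / 1000%:R * d + 3%:R.
Proof.
move=> t0 tq hd k0 kd hs.
set c := 362%:R / 1000%:R * d + 3%:R - t - q / 2%:R.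
(* Substitute [0.181] times the bound on [2 d], then [t <= q]; the coefficient of [q] is
   [0.181 * 6.291 - 0.5 - 0.819 > -0.181]. *)
have hc : - (181%:R / 1000%:R * q) + 3%:R <= c by rewrite /c; lra.
have q0 : 0 <= q by lra.
have d3 : 3%:R * q <= d by lra.
suff H : 0 <= k * c + q * (181%:R / 1000%:R * d).
  rewrite -subr_ge0 -(pmulr_rge0 _ k0).
  have -> : k * (362%:R / 1000%:R * d + 3%:R - (t + s)) =
    (k * c + q * (181%:R / 1000%:R * d)) +
    (q * (k - 362%:R / 1000%:R * d) - s * (2%:R * k)) / 2%:R.
    by rewrite /c; field.
  by rewrite addr_ge0 ?divr_ge0 ?subr_ge0 ?ler0n.
have [c0|c0] := lerP 0 c.
  by rewrite addr_ge0 // mulr_ge0 //; lra.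
(* For negative [c] the worst [k] is [d + 1]; the terms in [q d] then cancel, and [d3] covers the
   rest. *)
have H1 : 0 <= (d + 1 - k) * (- c) by rewrite mulr_ge0; lra.
have H2 : 0 <= (d + 1) * (c - (- (181%:R / 1000%:R * q) + 3%:R)) by rewrite mulr_ge0; lra.
have H3 : 0 <= q * d by rewrite mulr_ge0; lra.
lra.
Qed.

Lemma minor_of_many_edges (R : realType) (TH : finType) (eH : rel TH)
    (T : finType) (e : rel T) :
  simple_graph eH -> simple_graph e -> (0 < arcs eH)%N ->
  (2 * #|TH| <= arcs eH)%N -> (0 < #|T|)%N ->
  (#|TH|%:R + 6291%:R / 2000%:R * (arcs eH)%:R) * #|T|%:R <= (arcs e)%:R :> R ->
  is_minor eH e.
Proof.
move=> sH sE q0 tq T0 hD.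
have [q aq] : exists q, arcs eH = (2 * q)%N by exists (nedges eH); apply: arcs_nedges.
have t2 : (2 <= #|TH|)%N.
  have := leq_arcs_card (proj2 sH); rewrite aq in q0 *.
  by case: #|TH| => [|[|]] //; lia.
have tqR : #|TH|%:R <= q%:R :> R by rewrite ler_nat; lia.
have t2R : 2%:R <= #|TH|%:R :> R by rewrite ler_nat.
rewrite aq natrM in hD.
have [W1 [e1 [D [s1 m1 DD W10 [W1D deg1]]]]] :=
  half_degree_minor (esym (prednK T0)) sE hD.
pose d := D / 2%:R.
(* Here [q >= t >= 2], so [D >= 2 + 6.291 * 2 > 14]. *)
have d7 : 7%:R <= d by rewrite /d; lra.
have W1d : d <= #|W1|%:R - 1.
  have /card_gt0P[w _] := W10; apply: le_trans (deg1 w) _.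
  have := leq_deg_card w (proj2 s1); rewrite -(ler_nat R) -addn1 natrD; lra.
have W1d2 : #|W1|%:R - 1 <= 2%:R * d by rewrite /d; lra.
have a1 : #|W1|%:R * d <= (arcs e1)%:R.
  rewrite /arcs natr_sum mulr_natl -sumr_const; apply: ler_sum => w _.
  exact: deg1.
have thr : arc_threshold d #|W1|%:R <= (arcs e1)%:R.
  by apply: le_trans a1; apply: arc_threshold_le; lra.
have [|W [eW [k [sW mW cW kd dW]]]] := dense_minor d7 (erefl #|W1|) s1 W1d2 _ thr.
  by lra.
have [w0 _] : exists w : W, true.
  by have /card_gt0P[w] : (0 < #|W|)%N by [rewrite cW|]; exists w.
have [w _ wmin] := @arg_minnP W w0 xpredT (deg eW) isT.
have wk : (deg eW w <= k)%N by have := leq_deg_card w (proj2 sW); rewrite cW.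
have wkR : (deg eW w)%:R <= k%:R :> R by rewrite ler_nat.
have dw := dW w.
have dq : #|TH|%:R + 6291%:R / 1000%:R * q%:R <= 2%:R * d by rewrite /d; lra.
apply: is_minor_trans (is_minor_trans mW m1).
apply: (@dense_graph_minor _ _ eH eW k (k - deg eW w)) => //.
(* The degrees force [k >= 0.362 d], and [2 d >= 7.291 t] makes this at least [t]. *)
- apply: leqW; rewrite -(ler_nat R); lra.
- by move=> x; rewrite -{1}(subnKC wk) leq_add2r; apply: wmin.
move=> s; rewrite aq => hs.
have {}hs : (s * k <= q * (k - deg eW w))%N by move: hs; rewrite -!mulnA leq_pmul2l.
suff : #|TH|%:R + s%:R <= 362%:R / 1000%:R * d + 3%:R :> R.
  move=> H; have : (#|TH| + s + k <= 2 * deg eW w + 3)%N.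
    by rewrite -(ler_nat R) [X in _ <= X]natrD natrM !natrD; lra.
  by clear -wk; lia.
apply: (@room_for_subdivision R _ q%:R _ k%:R) => //; first lra.
move: hs; rewrite -(ler_nat R) !natrM natrB // => hs.
have : 0 <= q%:R * (2%:R * (deg eW w)%:R - (k%:R + 362%:R / 1000%:R * d)).
  by rewrite mulr_ge0 ?subr_ge0.
lra.
Qed.

(** * Induction on the number of vertices of [H] *)

(** From [b <= a / m] follows [a' m >= a (m - 1) - a]; bound the first [a] below by [D m] and the
    second above by [m (m - 1)]. *)
Lemma avg_degree_delete_vertex (R : realFieldType) (D m a a' b : R) :
  1 <= m -> D * m <= a -> a <= m * (m - 1) -> b * m <= a -> a = a' + 2%:R * b ->
  (D - 1) * (m - 1) <= a'.
Proof.
move=> m1 hD am bm aE; have -> : a' = a - 2%:R * b by lra.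
have h : 0 <= (m - 1) * (a - D * m) by rewrite mulr_ge0; lra.
rewrite -(@ler_pM2r _ m); last lra.
lra.
Qed.

(** The two sides differ by at least [s (D - s)]. *)
Lemma avg_degree_delete_set (R : realFieldType) (D m a a' s : R) :
  0 <= s -> s <= D -> D * m <= a -> a + s * s <= a' + 2%:R * s * m ->
  (D - 2%:R * s) * (m - s) <= a'.
Proof.
move=> s0 sD hD lost; have : 0 <= s * (D - s) by rewrite mulr_ge0; lra.
lra.
Qed.

Lemma minor_of_avg_degree (R : realType) n :
  forall (TH : finType) (eH : rel TH) (T : finType) (e : rel T),
  #|TH| = n -> simple_graph eH -> simple_graph e -> (0 < #|T|)%N ->
  (#|TH|%:R + 6291%:R / 2000%:R * (arcs eH)%:R) * #|T|%:R <= (arcs e)%:R :> R ->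
  is_minor eH e.
Proof.
elim/ltn_ind: n => n IH TH eH T e cH sH sE T0 hD.
have [symH irrH] := sH; have [symE irrE] := sE.
have [t0|t0] := posnP #|TH|.
  by exists (fun=> finset.set0); split=> u; have := card0_eq t0 u; rewrite inE.
set D : R := (#|TH|%:R + 6291%:R / 2000%:R * (arcs eH)%:R) in hD.
have TR : 1 <= #|T|%:R :> R by rewrite ler1n.
have tR : 1 <= #|TH|%:R :> R by rewrite ler1n.
have aR : 0 <= (arcs eH)%:R :> R by [].
have aT : (arcs e)%:R <= #|T|%:R * (#|T|%:R - 1) :> R.
  by have := leq_arcs_card irrE; rewrite -(ler_nat R) natrM natrB.
have DT : D <= #|T|%:R - 1.
  by rewrite -(@ler_pM2r _ #|T|%:R); lra.
have tD : #|TH|%:R <= D by rewrite /D; lra.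
have [/existsP[x /eqP dx]|noiso] := boolP [exists x, deg eH x == 0%N].
  have [v0 _] : exists v : T, true by have /card_gt0P[v] := T0; exists v.
  have [v _ vmin] := @arg_minnP T v0 xpredT (deg e) isT.
  have dv : (deg e v)%:R * #|T|%:R <= (arcs e)%:R :> R.
    by rewrite -natrM ler_nat mulnC -sum_nat_const leq_sum // => y _; apply: vmin.
  have noedge y : eH x y = false.
    by move/eqP: dx; rewrite sum_nat_eq0 => /forallP/(_ y); rewrite eqb0 => /negbTE.
  apply: (@minor_of_deleted _ _ eH e [set x] (fun=> v)) => //.
  - by apply/adj_closedP => u w /set1P->; rewrite noedge.
  - by move=> u w /set1P-> /set1P->.
  - by move=> u w /set1P-> _; rewrite noedge.
  have -> : (fun=> v) @: [set x] = [set v] by rewrite imset_set1.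
  have cH' : #|~: [set x]| = #|TH|.-1 by rewrite cardsC1.
  have cT' : #|~: [set v]| = #|T|.-1 by rewrite cardsC1.
  have cHR : #|~: [set x]|%:R = #|TH|%:R - 1 :> R by rewrite cH' -subn1 natrB.
  have cTR : #|~: [set v]|%:R = #|T|%:R - 1 :> R by rewrite cT' -subn1 natrB.
  apply: (IH #|~: [set x]|); rewrite ?card_induced //.
  + by rewrite cH' -cH prednK.
  + exact: induced_simple.
  + exact: induced_simple.
  + by rewrite -(ltr_nat R) cTR; lra.
  rewrite !arcs_induced cHR cTR.
  have <- : arcs eH = arcs_in eH (~: [set x]) by rewrite (arcs_in_setC1 x sH) dx addn0.
  have aE := arcs_in_setC1 v sE.
  have aER : (arcs e)%:R = (arcs_in e (~: [set v]))%:R + 2%:R * (deg e v)%:R :> R.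
    by rewrite aE natrD natrM.
  rewrite (_ : #|TH|%:R - 1 + _ = D - 1); last by rewrite /D; lra.
  apply: avg_degree_delete_vertex hD aT dv aER; lra.
have noiso' x : (0 < deg eH x)%N.
  by rewrite lt0n; apply: contra noiso => dx; apply/existsP; exists x.
(* Without isolated vertices, deleting a closed [S] removes at least [#|S|] arcs from [H]. *)
have arcs_ge (S : {set TH}) : adj_closed eH S -> (#|S| <= arcs_in eH S)%N.
  move=> /adj_closedP clS; rewrite -sum1_card; apply: leq_sum => x xS.
  rewrite -[deg_in _ _ _]addn0 -[X in (_ + X)%N](@deg_in_eq0 _ eH (setT :\: S) x);
    last first.
    by move=> y; rewrite setTD inE; apply: contra; apply: clS.
  by rewrite -deg_in_split ?subsetT // deg_inT.
have aH : (#|TH| <= arcs eH)%N.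
  by rewrite -arcs_inT -cardsT; apply: arcs_ge; apply/adj_closedP => u v _ _; rewrite inE.
have [tq|qt] := leqP (2 * #|TH|) (arcs eH).
  by apply: (@minor_of_many_edges R) => //; apply: leq_trans aH.
have [S [S0 clS degen]] := tree_component sH qt.
have D0 : 0 < D by lra.
have [U [U0 hU]] := min_degree_core sE T0 D0 hD.
have aHR : #|TH|%:R <= (arcs eH)%:R :> R by rewrite ler_nat.
have cS : (#|S| <= #|TH|)%N := max_card _.
have cSR : #|S|%:R <= #|TH|%:R :> R by rewrite ler_nat.
have [|f [finj fhom]] := greedy_embedding sH symE degen U0.
  (* Since [arcs eH >= #|TH|], [D / 2] exceeds [2 #|TH|], which is ample for [#|S|]. *)
  move=> y yU; have := hU y yU; rewrite -(ler_nat R) /D; lra.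
apply: (@minor_of_deleted _ _ eH e S f) => //.
have cf : #|f @: S| = #|S| by rewrite card_in_imset.
have cST : (#|S| <= #|T|)%N by rewrite -cf max_card.
have cH' : #|~: S|%:R = #|TH|%:R - #|S|%:R :> R by rewrite cardsCs finset.setCK natrB.
have cT' : #|~: (f @: S)|%:R = #|T|%:R - #|S|%:R :> R.
  by rewrite cardsCs finset.setCK cf natrB.
apply: (IH #|~: S|); rewrite ?card_induced //.
- by rewrite -cH -(cardsC S) -[X in (X < _)%N]add0n ltn_add2r.
- exact: induced_simple.
- exact: induced_simple.
- by rewrite -(ltr_nat R) cT'; lra.
rewrite !arcs_induced cH' cT'.
have aSR : (arcs eH)%:R = (arcs_in eH S)%:R + (arcs_in eH (~: S))%:R :> R.
  by rewrite (arcs_in_closedC symH clS) natrD.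
have aS : #|S|%:R <= (arcs_in eH S)%:R :> R by rewrite ler_nat arcs_ge.
have lost := leq_arcs_in_setC e (f @: S).
have {}lost : (arcs e)%:R + #|S|%:R * #|S|%:R <=
    (arcs_in e (~: (f @: S)))%:R + 2%:R * #|S|%:R * #|T|%:R :> R.
  by move: lost; rewrite cf -(ler_nat R) natrD [X in _ <= X]natrD !natrM.
apply: (@le_trans _ _ ((D - 2%:R * #|S|%:R) * (#|T|%:R - #|S|%:R))).
  apply: ler_wpM2r; first by rewrite subr_ge0 ler_nat.
  (* The bound required for [H] drops by at least [(1 + 3.1455) #|S|], more than the [2 #|S|] lost
     in the average degree. *)
  by have : 0 <= #|S|%:R :> R by []; rewrite /D; lra.
by apply: avg_degree_delete_set hD lost => //; lra.
Qed.


From mathcomp Require Import all_classical all_reals.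
From mathcomp Require Import ereal.

Theorem theorem2 (R : realType) (TH : finType) (eH : rel TH) :
  simple_graph eH ->
  (fH R eH <= ((#|TH|%:R + (6291%:R / 1000%:R) * (nedges eH)%:R)%R : R)%:E)%E.
Proof.
move=> sH; apply: ereal_inf_lbound.
exists (#|TH|%:R + 6291%:R / 1000%:R * (nedges eH)%:R)%R => // T e sE hd.
have [t0|t0] := posnP #|TH|.
  by exists (fun=> finset.set0); split=> u; have := card0_eq t0 u; rewrite inE.
have tR : (1 <= #|TH|%:R :> R)%R by rewrite ler1n.
have qR : (0 <= (nedges eH)%:R :> R)%R by [].
(* On the empty graph division by zero makes the average degree 0, below the bound, which is at
   least 1. *)
have T0 : (0 < #|T|)%N.
  rewrite lt0n; apply/eqP => T0; move: hd.
  by rewrite /avg_degree T0 invr0 mulr0; lra.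
apply: (@minor_of_avg_degree R #|TH|) => //.
move: hd; rewrite /avg_degree ler_pdivlMr ?ltr0n // -arcs_nedges //.
apply: le_trans; apply: ler_wpM2r => //.
by rewrite arcs_nedges // natrM; lra.
Qed.
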